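(* Let $\mathbb{F}$ be a field, let $n,m\ge 1$ be integers, and let $r$ be an integer with $1\le r\le \min(n,m)$. Let $J\subseteq\{1,\ldots,n\}\times\{1,\ldots,m\}$ be a banded pattern and let $\mathcal{A}=\{a_{ij}\in\mathbb{F} : (i,j)\in J\}$ be an $n\times m$ partial matrix over $\mathbb{F}$ with pattern $J$. Suppose that (1) every fully specified submatrix of $\mathcal{A}$ has full rank, i.e. for all nonempty $R\subseteq\{1,\ldots,n\}$ and $C\subseteq\{1,\ldots,m\}$ with $R\times C\subseteq J$, the matrix $(a_{ij})_{i\in R,\,j\in C}$ has rank $\min(|R|,|C|)$; and (2) for every integer $k$ with $r\le k\le\min(n,m)$, every $k\times k$ submatrix has at most $(2k-r)r$ specified entries, i.e. $|J\cap(R\times C)|\le(2k-r)r$ for all $R\subseteq\{1,\ldots,n\}$ and $C\subseteq\{1,\ldots,m\}$ with $|R|=|C|=k$. Then there exists a completion of $\mathcal{A}$ of rank $r$, i.e. a matrix $B=(b_{ij})\in\mathbb{F}^{n\times m}$ with $b_{ij}=a_{ij}$ for all $(i,j)\in J$ and $\operatorname{rank} B=r$.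
   Context: A partial matrix over $\mathbb{F}$ of size $n\times m$ with pattern $J\subseteq\{1,\ldots,n\}\times\{1,\ldots,m\}$ is a collection $\{a_{ij}\in\mathbb{F}:(i,j)\in J\}$; the entries in positions $(i,j)\in J$ are called specified and those in the other positions are unknown (free). A completion is an $n\times m$ matrix over $\mathbb{F}$ that agrees with the specified entries. A submatrix is obtained by choosing an arbitrary set of rows and an arbitrary set of columns (not necessarily consecutive); it is fully specified if all its positions lie in $J$. A pattern $J$ is called banded if whenever $(i,j)\in J$ and $(p,q)\in J$ with $i\le p$ and $j\ge q$, then $\{i,i+1,\ldots,p\}\times\{q,q+1,\ldots,j\}\subseteq J$ (equivalently, $J$ is the intersection of a block lower triangular (staircase) pattern and a block upper triangular (staircase) pattern). *)

(* Defs.v *)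
From mathcomp Require Import all_boot all_order all_algebra.

Set Implicit Arguments.
Unset Strict Implicit.
Unset Printing Implicit Defensive.

Local Open Scope ring_scope.

(* The entry [None] is an unknown one. *)
Definition partial_matrix (F : fieldType) (n m : nat) := 'M[option F]_(n, m).

Definition pattern (F : fieldType) (n m : nat) (A : partial_matrix F n m) :
    {set 'I_n * 'I_m} :=
  [set ij : 'I_n * 'I_m | isSome (A ij.1 ij.2)].

Definition is_completion (F : fieldType) (n m : nat)
    (A : partial_matrix F n m) (B : 'M[F]_(n, m)) : Prop :=
  forall (i : 'I_n) (j : 'I_m) (x : F), A i j = Some x -> B i j = x.

(* The default value 0 is junk: this is the submatrix of [A] on the rows [R]
   and columns [C] only when [setX R C \subset pattern A]. *)
Definition specified_submx (F : fieldType) (n m : nat)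
    (A : partial_matrix F n m) (R : {set 'I_n}) (C : {set 'I_m}) :
    'M[F]_(#|R|, #|C|) :=
  \matrix_(i, j) odflt 0 (A (enum_val i) (enum_val j)).

Definition banded (n m : nat) (J : {set 'I_n * 'I_m}) : Prop :=
  forall (i p : 'I_n) (j q : 'I_m),
    (i, j) \in J -> (p, q) \in J -> (i <= p)%N -> (q <= j)%N ->
    forall (s : 'I_n) (t : 'I_m),
      (i <= s <= p)%N -> (q <= t <= j)%N -> (s, t) \in J.

(* Main.v *)
Require Import Defs.
From mathcomp Require Import all_boot all_order all_algebra.
From mathcomp Require Import zify.

Set Implicit Arguments.
Unset Strict Implicit.
Unset Printing Implicit Defensive.

Import GRing.Theory.
Local Open Scope ring_scope.

(** Write J for the pattern of A.  A completion of rank at most r is a product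
    U V^T with U of width r, that is, a choice of vectors u_i (one per row) and
    v_j (one per column) in F^r with u_i . v_j = a_ij on J.  The vectors are
    chosen one at a time, following the band from its top left end to its
    bottom right end.  At a moment where rows < i and columns < j have been
    treated, let P be the set of treated rows that still have a specified entry
    in a column >= j, and Q the set of treated columns that still have one in a
    row >= i; these are the active rows and columns.  The invariant is that
    (u_k), k in P, and (v_c), c in Q, are linearly independent families.

    A new u_i has to satisfy one linear equation for each specified entry of
    row i in a treated column; such a column lies in Q, hence the equations are
    independent and solvable.  If row i has no specified entry in a column >= j,
    it does not become active, and any solution will do ([add_dead_row]).  The
    same holds for columns.  If neither row i nor column j is dead in this
    sense, bandedness makes the block (P + i) x (Q + j) fully specified
    ([active_block]).  The sparsity hypothesis with k = r + 1 forbids a fully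
    specified square of size r + 1, since (r + 2) r < (r + 1)^2; therefore
    min(|P|, |Q|) < r.  The smaller of P and Q can now grow: if |P| <= |Q|, full
    rank of the block gives a solution u_i outside the span of the active u_k
    ([solve_outside], [add_live_row]); if |Q| <= |P|, the transposed argument
    adds column j.  No genericity is involved, so the field may be finite.

    It remains to reach rank exactly r, which is done one unit at a time
    ([increase_rank]).  If rank B < min(n, m), take nonzero x and y with
    x B = 0 and B y = 0.  Were supp x * supp y fully specified, that submatrix
    would have dependent rows and dependent columns, against full rank.  Hence
    some free position (i, j) has x_i and y_j nonzero, and adding 1 there
    increases the rank by exactly one. *)

(** * Families of rows of a matrix *)

Section Rows.
Variable F : fieldType.

Definition rows n r (P : {set 'I_n}) (U : 'M[F]_(n, r)) : 'M_(#|P|, r) :=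
  \matrix_(k < #|P|) row (enum_val k) U.

Lemma rows_subP n r q (P : {set 'I_n}) (U : 'M[F]_(n, r)) (W : 'M_(q, r)) :
  reflect (forall i, i \in P -> (row i U <= W)%MS) (rows P U <= W)%MS.
Proof.
apply: (iffP row_subP) => UW i.
  by move=> iP; have := UW (enum_rank_in iP i); rewrite rowK enum_rankK_in.
by rewrite rowK; apply/UW/enum_valP.
Qed.

Lemma row_sub_rows n r (P : {set 'I_n}) (U : 'M[F]_(n, r)) i :
  i \in P -> (row i U <= rows P U)%MS.
Proof. by move: i; apply/rows_subP. Qed.

Lemma rowsU1 n r (P : {set 'I_n}) (U : 'M[F]_(n, r)) i :
  (rows (i |: P) U :=: row i U + rows P U)%MS.
Proof.
apply/eqmxP/andP; split.
  apply/rows_subP => k /setU1P[-> | kP]; first exact: addsmxSl.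
  by rewrite (submx_trans (row_sub_rows _ kP)) ?addsmxSr.
rewrite addsmx_sub row_sub_rows ?setU11 //.
by apply/rows_subP => k kP; rewrite row_sub_rows // setU1r.
Qed.

Lemma row_free_rowsS n r (P Q : {set 'I_n}) (U : 'M[F]_(n, r)) :
  P \subset Q -> row_free (rows Q U) -> row_free (rows P U).
Proof.
move=> sPQ /eqP freeQ; rewrite /row_free eqn_leq rank_leq_row /=.
have: (rows Q U <= rows P U + rows (Q :\: P) U)%MS.
  apply/rows_subP => i iQ; have [iP | niP] := boolP (i \in P).
    by rewrite (submx_trans (row_sub_rows _ iP)) ?addsmxSl.
  have iQP : i \in Q :\: P by rewrite inE niP.
  by rewrite (submx_trans (row_sub_rows _ iQP)) ?addsmxSr.
move/mxrankS; rewrite freeQ.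
have := rank_leq_row (rows (Q :\: P) U).
have := (mxrank_adds_leqif (rows P U) (rows (Q :\: P) U)).1.
have := cardsID P Q; rewrite (setIidPr sPQ) => <- le1 le2 le3.
rewrite -(leq_add2r #|Q :\: P|).
exact: leq_trans le3 (leq_trans le1 (leq_add (leqnn _) le2)).
Qed.

Lemma row_free_rowsU1 n r (P : {set 'I_n}) (U : 'M[F]_(n, r)) i :
  row_free (rows P U) -> ~~ (row i U <= rows P U)%MS ->
  row_free (rows (i |: P) U).
Proof.
move=> /eqP freeP iU.
have niP : i \notin P by apply: contra iU; apply: row_sub_rows.
rewrite /row_free rowsU1 cardsU1 niP.
have ltr: (rows P U < row i U + rows P U)%MS.
  by rewrite ltmxE addsmxSr addsmx_sub submx_refl andbT.
have := rank_ltmx ltr; rewrite freeP eqn_leq => ->; rewrite andbT.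
have := (mxrank_adds_leqif (row i U) (rows P U)).1; rewrite freeP.
move/leq_trans; apply; rewrite leq_add2r; exact: rank_leq_row.
Qed.

Lemma eq_rows n r (P : {set 'I_n}) (U U' : 'M[F]_(n, r)) :
  (forall i, i \in P -> row i U = row i U') -> rows P U = rows P U'.
Proof.
by move=> eqU; apply/row_matrixP => k; rewrite !rowK eqU // enum_valP.
Qed.

(** * Solving for the next vector *)

Lemma solve_free q r (V : 'M[F]_(q, r)) (b : 'rV_q) :
  row_free V -> exists u : 'rV_r, u *m V^T = b.
Proof.
move=> freeV; exists (b *m pinvmx V^T); apply/mulmxKpV/submx_full.
by rewrite /row_full mxrank_tr.
Qed.

(** The reason is a dichotomy.  Suppose that one solution u lies in the row
    space of U.  Then b = u V^T lies in that of U V^T, which is only permitted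
    when p = q.  But p = q < r leaves a nonzero k with k V^T = 0, and such a k
    is outside the row space of U because U V^T has independent rows; u + k is
    then the required solution. *)
Lemma solve_outside p q r (U : 'M[F]_(p, r)) (V : 'M_(q, r)) (b : 'rV_q) :
    row_free V -> (p < r)%N -> (p <= q)%N -> row_free (U *m V^T) ->
    ((p < q)%N -> ~~ (b <= U *m V^T)%MS) ->
  exists u : 'rV_r, u *m V^T = b /\ ~~ (u <= U)%MS.
Proof.
move=> freeV ltpr lepq freeUV bUV.
have [u uV] := solve_free b freeV.
have [uU | uU] := boolP (u <= U)%MS; last by exists u.
have eqpq : p = q.
  apply/eqP; rewrite eqn_leq lepq leqNgt; apply/negP => /bUV.
  by rewrite -uV submxMr.
have : kermx V^T != 0.
  by rewrite kermx_eq0 /row_free mxrank_tr (eqP freeV) -eqpq neq_ltn ltpr.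
case/rowV0Pn => k /sub_kermxP kV k0; exists (u + k); split.
  by rewrite mulmxDl uV kV addr0.
apply: contra k0 => ukU.
have /submxP[z kz] : (k <= U)%MS.
  by rewrite -[k](addKr u) addmx_sub // eqmx_opp.
have : z *m (U *m V^T) = 0 *m (U *m V^T) by rewrite mulmxA -kz kV mul0mx.
by move/(row_free_inj freeUV) => z0; rewrite kz z0 mul0mx.
Qed.

End Rows.

Section Completion.
Variable F : fieldType.

(** * Hypotheses on the partial matrix, and their invariance by transposition *)

Definition full_rank n m (A : partial_matrix F n m) : Prop :=
  forall (R : {set 'I_n}) (C : {set 'I_m}), setX R C \subset pattern A ->
    \rank (specified_submx A R C) = minn #|R| #|C|.

(** Sparsity acts through this property: a fully specified square of size r + 1
    has (r + 1)^2 entries, one more than the bound for k = r + 1 allows. *)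
Definition thin r n m (A : partial_matrix F n m) : Prop :=
  forall (R : {set 'I_n}) (C : {set 'I_m}), setX R C \subset pattern A ->
    (minn #|R| #|C| <= r)%N.

Lemma mem_pattern n m (A : partial_matrix F n m) i j :
  ((i, j) \in pattern A) = isSome (A i j).
Proof. by rewrite inE. Qed.

Lemma mem_pattern_tr n m (A : partial_matrix F n m) i j :
  ((j, i) \in pattern A^T) = ((i, j) \in pattern A).
Proof. by rewrite !inE mxE. Qed.

Lemma setX_pattern_tr n m (A : partial_matrix F n m) R C :
  (setX C R \subset pattern A^T) = (setX R C \subset pattern A).
Proof.
apply/subsetP/subsetP => sub [x y] /setXP[/= xR yC].
  by rewrite -mem_pattern_tr sub // inE yC.
by rewrite mem_pattern_tr sub // inE yC.
Qed.

Lemma specified_submx_tr n m (A : partial_matrix F n m) R C :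
  specified_submx A^T C R = (specified_submx A R C)^T.
Proof. by apply/matrixP => i j; rewrite !mxE. Qed.

Lemma full_rank_tr n m (A : partial_matrix F n m) :
  full_rank A -> full_rank A^T.
Proof.
move=> fullA C R; rewrite setX_pattern_tr => /fullA; rewrite minnC => <-.
by rewrite specified_submx_tr mxrank_tr.
Qed.

Lemma thin_tr r n m (A : partial_matrix F n m) : thin r A -> thin r A^T.
Proof. by move=> thinA C R; rewrite setX_pattern_tr minnC => /thinA. Qed.

(** * Active rows and columns *)

(** Active columns are obtained as [active A^T j i], so that each statement about
    adding a row also serves, by transposition, for adding a column. *)
Definition active n m (A : partial_matrix F n m) (i j : nat) : {set 'I_n} :=
  [set k : 'I_n | (k < i)%N &&
    [exists c : 'I_m, (j <= c)%N && ((k, c) \in pattern A)]].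

Lemma activeP n m (A : partial_matrix F n m) i j (k : 'I_n) :
  reflect ((k < i)%N /\
           exists2 c : 'I_m, (j <= c)%N & (k, c) \in pattern A)
    (k \in active A i j).
Proof.
rewrite inE; apply: (iffP andP) => -[ki].
  by case/existsP => c /andP[jc kcA]; split => //; exists c.
by case=> c jc kcA; split => //; apply/existsP; exists c; rewrite jc.
Qed.

Lemma active_tr_S n m (A : partial_matrix F n m) i j :
  active A^T j i.+1 \subset active A^T j i.
Proof.
apply/subsetP => c /activeP[cj [k ik kcA]]; apply/activeP; split => //.
by exists k => //; apply: ltnW.
Qed.

(** Take s in the set of rows and t in the set of columns.  Row s lies weakly
    above i and has a specified entry in a column c >= j; column t lies weakly
    left of j and has a specified entry in a row k >= i.  So (s, c) and (k, t)
    are the top right and bottom left corners of a rectangle, fully specified by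
    bandedness, which contains (s, t). *)
Lemma active_block n m (A : partial_matrix F n m) (i : 'I_n) (j : 'I_m) :
  banded (pattern A) ->
  (exists2 c : 'I_m, (j <= c)%N & (i, c) \in pattern A) ->
  (exists2 k : 'I_n, (i <= k)%N & (k, j) \in pattern A) ->
  setX (i |: active A i j) (j |: active A^T j i) \subset pattern A.
Proof.
move=> bandA aliveR aliveC; apply/subsetP => -[s t] /setXP[/= sR tC].
have [c [jc scA ls]] : exists c : 'I_m,
    [/\ (j <= c)%N, (s, c) \in pattern A & (s <= i)%N].
  case/setU1P: sR aliveR => [-> [c] | /activeP[si [c]]]; first by exists c.
  by exists c; split => //; apply: ltnW.
have [k [ik ktA lt]] : exists k : 'I_n,
    [/\ (i <= k)%N, (k, t) \in pattern A & (t <= j)%N].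
  case/setU1P: tC aliveC => [-> [k] | /activeP[tj [k]]]; first by exists k.
  by rewrite mem_pattern_tr; exists k; split => //; apply: ltnW.
by apply: (bandA _ _ _ _ scA ktA); lia.
Qed.

(** * Building the factorization along the band *)

Record partial_factorization r n m (A : partial_matrix F n m) (i j : nat)
    (U : 'M[F]_(n, r)) (V : 'M[F]_(m, r)) : Prop := PartialFactorization {
  pf_agree : forall (k : 'I_n) (c : 'I_m) x, (k < i)%N -> (c < j)%N ->
    A k c = Some x -> (U *m V^T) k c = x;
  pf_rows : row_free (rows (active A i j) U);
  pf_cols : row_free (rows (active A^T j i) V) }.

Lemma partial_factorization_tr r n m (A : partial_matrix F n m) i j
    (U : 'M[F]_(n, r)) V :
  partial_factorization A i j U V -> partial_factorization A^T j i V U.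
Proof.
case=> agree freeU freeV; split; rewrite ?trmxK // => c k x cj ki.
rewrite mxE => /(agree _ _ _ ki cj) <-.
by rewrite -[V]trmxK -trmx_mul trmxK mxE.
Qed.

Lemma mul_rows_submx r n m (A : partial_matrix F n m) (R : {set 'I_n})
    (C : {set 'I_m}) (U : 'M[F]_(n, r)) (V : 'M[F]_(m, r)) :
  setX R C \subset pattern A ->
  (forall k c x, k \in R -> c \in C -> A k c = Some x ->
     (U *m V^T) k c = x) ->
  rows R U *m (rows C V)^T = specified_submx A R C.
Proof.
move=> /subsetP RCJ agree; apply/matrixP => k c.
set k' := enum_val k; set c' := enum_val c.
have k'R : k' \in R := enum_valP k; have c'C : c' \in C := enum_valP c.
have /RCJ : (k', c') \in setX R C by rewrite inE k'R.
rewrite mem_pattern; case Ekc: (A k' c') => [x|] // _.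
rewrite [RHS]mxE Ekc /= -(agree k' c' x) // !mxE.
by apply: eq_bigr => l _; rewrite !mxE.
Qed.

(** Only the active columns occur in the equations on u: a treated column with
    a specified entry in row i is active, because of that very entry.  Entries
    at untreated columns are dealt with when those columns are added.  At an
    active column where row i is unspecified, the value 0 is an arbitrary
    choice. *)
Lemma add_row r n m (A : partial_matrix F n m) (i : 'I_n) j
    (U : 'M[F]_(n, r)) V (u : 'rV_r) :
    partial_factorization A i j U V ->
    u *m (rows (active A^T j i) V)^T =
      \row_k odflt 0 (A i (enum_val k)) ->
    (i \in active A i.+1 j -> ~~ (u <= rows (active A i j) U)%MS) ->
  exists U', partial_factorization A i.+1 j U' V.
Proof.
case=> agree freeU freeV uV uU.
pose U' : 'M[F]_(n, r) := \matrix_(k < n) if k == i then u else row k U.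
have row_ne k : k != i -> row k U' = row k U.
  by move=> ki; rewrite rowK (negPf ki).
have row_i : row i U' = u by rewrite rowK eqxx.
have prodE k c : (U' *m V^T) k c = (row k U' *m (row c V)^T) 0 0.
  by rewrite !mxE; apply: eq_bigr => l _; rewrite !mxE.
have eqU : rows (active A i j) U' = rows (active A i j) U.
  by apply: eq_rows => k /activeP[ki _]; rewrite row_ne // neq_ltn ki.
have niS k : k \in active A i.+1 j -> k != i -> k \in active A i j.
  case/activeP => ki alive_k ne_ki; apply/activeP; split=> //.
  by move: ki; rewrite ltnS leq_eqVlt val_eqE (negPf ne_ki).
exists U'; split.
- move=> k c x; rewrite ltnS leq_eqVlt => /predU1P[/val_inj -> | ki] cj kcA.
    have cQ : c \in active A^T j i.
      by apply/activeP; split=> //; exists i; rewrite ?mem_pattern_tr ?inE ?kcA.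
    have := congr1 (fun w : 'rV_ _ => w 0 (enum_rank_in cQ c)) uV.
    rewrite mxE [RHS]mxE enum_rankK_in // kcA prodE row_i => /= <-.
    by rewrite mxE; apply: eq_bigr => l _; rewrite !mxE enum_rankK_in.
  have := agree _ _ _ ki cj kcA; rewrite prodE row_ne ?neq_ltn ?ki // => <-.
  by rewrite !mxE; apply: eq_bigr => l _; rewrite !mxE.
- have [iS | iS] := boolP (i \in active A i.+1 j).
    apply: (row_free_rowsS (Q := i |: active A i j)).
      apply/subsetP => k kS; rewrite in_setU1.
      by case: eqVneq => //= /(niS _ kS).
    by apply: row_free_rowsU1; rewrite eqU ?row_i ?uU.
  apply: (row_free_rowsS (Q := active A i j)); last by rewrite eqU.
  apply/subsetP => k kS; apply: (niS _ kS).
  by apply: contraNneq iS => eq_ki; rewrite eq_ki in kS.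
- exact: row_free_rowsS (active_tr_S A i j) freeV.
Qed.

Lemma add_dead_row r n m (A : partial_matrix F n m) (i : 'I_n) j
    (U : 'M[F]_(n, r)) V :
    partial_factorization A i j U V -> i \notin active A i.+1 j ->
  exists U', partial_factorization A i.+1 j U' V.
Proof.
move=> pfUV dead; case: (pfUV) => _ _ /solve_free solveV.
have [u uV] := solveV (\row_k odflt 0 (A i (enum_val k))).
by apply: (add_row pfUV uV) => /(negP dead).
Qed.

(** The side conditions of [solve_outside] come from the block.  As |P| <= |Q|,
    the smaller side of the block has |P| + 1 elements, which thinness bounds by
    r; and by full rank the rows of A on P, restricted to Q, are independent, as
    are those on P + i if |P| < |Q|. *)
Lemma add_live_row r n m (A : partial_matrix F n m) (i : 'I_n) (j : 'I_m)
    (U : 'M[F]_(n, r)) V :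
    full_rank A -> thin r A -> partial_factorization A i j U V ->
    setX (i |: active A i j) (j |: active A^T j i) \subset pattern A ->
    (#|active A i j| <= #|active A^T j i|)%N ->
  exists U', partial_factorization A i.+1 j U' V.
Proof.
move=> fullA thinA pfUV; set P := active A i j; set Q := active A^T j i.
move=> block lePQ; case: (pfUV) => agree freeU freeV.
have niP : i \notin P by rewrite inE ltnn.
have njQ : j \notin Q by rewrite inE ltnn.
have ltPr : (#|P| < r)%N.
  apply: leq_trans (thinA _ _ block); rewrite !cardsU1 niP njQ.
  by rewrite leq_min ltnS leqnn ltnS lePQ.
have blockPQ : setX P Q \subset pattern A.
  apply: subset_trans block; apply: setXS; exact: subsetU1.
have blockiPQ : setX (i |: P) Q \subset pattern A.
  by apply: subset_trans block; apply: setXS => //; apply: subsetU1.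
have UVE : rows P U *m (rows Q V)^T = specified_submx A P Q.
  apply: mul_rows_submx => // k c x /activeP[ki _] /activeP[cj _].
  exact: agree.
have freeUV : row_free (rows P U *m (rows Q V)^T).
  by rewrite /row_free UVE fullA // (minn_idPl lePQ).
pose b := \row_(k < #|Q|) odflt 0 (A i (enum_val k)).
have outside : (#|P| < #|Q|)%N -> ~~ (b <= rows P U *m (rows Q V)^T)%MS.
  rewrite UVE => ltPQ; apply/negP => iPQ.
  pose M := \matrix_(k < n, c < #|Q|) odflt 0 (A k (enum_val c)).
  have subE R : specified_submx A R Q = rows R M.
    by apply/matrixP => k c; rewrite !mxE.
  have rowE : row i M = b by apply/rowP => c; rewrite !mxE.
  have: (rows (i |: P) M <= rows P M)%MS.
    by rewrite rowsU1 addsmx_sub submx_refl andbT rowE -subE.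
  move/mxrankS; rewrite -!subE !fullA // cardsU1 niP.
  by rewrite (minn_idPl ltPQ) (minn_idPl lePQ) ltnn.
have [u [uV uU]] := solve_outside freeV ltPr lePQ freeUV outside.
exact: (add_row pfUV uV).
Qed.

(** The new row and the new column cannot both get stuck: a dead one can always
    be added, and of two live ones the one on the side with fewer active vectors
    can.  When all rows are treated every remaining column is dead, and
    conversely. *)
Lemma add_row_or_column r n m (A : partial_matrix F n m) i j
    (U : 'M[F]_(n, r)) V :
    banded (pattern A) -> full_rank A -> thin r A ->
    partial_factorization A i j U V -> (i < n)%N || (j < m)%N ->
  (i < n)%N /\ (exists U', partial_factorization A i.+1 j U' V) \/
  (j < m)%N /\ (exists V', partial_factorization A i j.+1 U V').
Proof.
move=> bandA fullA thinA pfUV ltij.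
have pfVU := partial_factorization_tr pfUV.
have stepC W : partial_factorization A^T j.+1 i W U ->
    exists V', partial_factorization A i j.+1 U V'.
  by move/partial_factorization_tr; rewrite trmxK; exists W.
have [ltin | lein] := ltnP i n; last first.
  have {ltij} ltjm : (j < m)%N by move: ltij; rewrite ltnNge lein.
  have dead : Ordinal ltjm \notin active A^T (Ordinal ltjm).+1 i.
    by apply/negP => /activeP[_ [k le_ik]]; have := ltn_ord k; lia.
  right; split=> //.
  by have [V' /stepC] := add_dead_row (i := Ordinal ltjm) pfVU dead.
pose i' := Ordinal ltin.
have [aliveR | dead] := boolP (i' \in active A i.+1 j); last first.
  left; split=> //; exact: (add_dead_row (i := i') pfUV dead).
have {aliveR} [c0 jc0 ic0A] : exists2 c : 'I_m, (j <= c)%N &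
  (i', c) \in pattern A by case/activeP: aliveR.
have ltjm : (j < m)%N by apply: leq_ltn_trans jc0 _.
pose j' := Ordinal ltjm.
have [aliveC | dead] := boolP (j' \in active A^T j.+1 i); last first.
  by right; split=> //; have [V' /stepC] := add_dead_row (i := j') pfVU dead.
have {aliveC} [k0 ik0 kj0A] : exists2 k : 'I_n, (i <= k)%N &
  (k, j') \in pattern A.
  by case/activeP: aliveC => _ [k]; rewrite mem_pattern_tr; exists k.
have block : setX (i' |: active A i j) (j' |: active A^T j i) \subset pattern A.
  by apply: (active_block (i := i') (j := j') bandA); [exists c0 | exists k0].
have [lePQ | /ltnW leQP] := leqP #|active A i j| #|active A^T j i|.
  left; split=> //.
  exact: (add_live_row (i := i') (j := j') fullA thinA pfUV block lePQ).
right; split=> //; have [||V' /stepC//] :=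
    @add_live_row r m n A^T j' i' V U (full_rank_tr fullA) (thin_tr thinA) pfVU.
- by rewrite trmxK setX_pattern_tr.
- by rewrite trmxK.
Qed.

Lemma exists_factorization r n m (A : partial_matrix F n m) :
    banded (pattern A) -> full_rank A -> thin r A ->
  exists (U : 'M[F]_(n, r)) (V : 'M[F]_(m, r)), is_completion A (U *m V^T).
Proof.
move=> bandA fullA thinA.
suff grow i j (U : 'M[F]_(n, r)) (V : 'M[F]_(m, r)) :
    partial_factorization A i j U V ->
    exists (U : 'M[F]_(n, r)) (V : 'M[F]_(m, r)), is_completion A (U *m V^T).
  apply: (grow 0%N 0%N 0 0).
  have free0 n' m' (B : partial_matrix F n' m') (W : 'M[F]_(n', r)) :
      row_free (rows (active B 0 0) W).
    have card0 : #|active B 0 0| = 0%N by apply: eq_card0 => k; rewrite inE.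
    by rewrite /row_free eqn_leq rank_leq_row {1}card0.
  by split.
have [d] := ubnP (n - i + (m - j))%N.
elim: d i j U V => // d IHd i j U V le_d pfUV.
have [todo | /norP[]] := boolP ((i < n)%N || (j < m)%N); last first.
  rewrite -!leqNgt => lein lejm; exists U, V => k c x.
  by apply: pf_agree pfUV _ _ _ _ _; rewrite (leq_trans (ltn_ord _)).
have [[ltin [U' pf']] | [ltjm [V' pf']]] :=
  add_row_or_column bandA fullA thinA pfUV todo.
  by apply: IHd pf'; lia.
by apply: IHd pf'; lia.
Qed.

(** * Raising the rank *)

(** Since x (B + E_ij) = x_i e_j, the row e_j lies in the row space of B + E_ij,
    and so do the rows of B; but e_j is not in the row space of B, because y is
    orthogonal to B and not to e_j. *)
Lemma mxrank_add_delta n m (B : 'M[F]_(n, m)) (x : 'rV_n) (y : 'cV_m) i j :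
  x *m B = 0 -> B *m y = 0 -> x 0 i != 0 -> y j 0 != 0 ->
  \rank (B + delta_mx i j)%R = (\rank B).+1.
Proof.
move=> xB By xi yj; set M := (X in \rank X = _).
pose e := delta_mx 0 j : 'rV[F]_m.
have deltaE : delta_mx i j = delta_mx i 0 *m e by rewrite mul_delta_mx.
have eM : (e <= M)%MS.
  have -> : e = (x 0 i)^-1 *: x *m M; last exact: submxMl.
  rewrite -scalemxAl /M mulmxDr xB add0r deltaE mulmxA -colE.
  by rewrite [col i x]mx11_scalar mxE mul_scalar_mx scalerA mulVf ?scale1r.
have BM : (B <= M)%MS.
  rewrite -[B](addrK (delta_mx i j)) addmx_sub // eqmx_opp deltaE.
  exact: mulmx_sub.
have eB : ~~ (e <= B)%MS.
  apply: contra yj => /submxP[z eE].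
  have := congr1 (fun w => (w *m y) 0 0) eE.
  by rewrite /e -rowE -mulmxA By mulmx0 !mxE => ->.
apply/eqP; rewrite eqn_leq; apply/andP; split.
  apply: leq_trans (mxrank_add _ _) _.
  by rewrite mxrank_delta addn1.
apply: rank_ltmx; rewrite ltmxE BM; apply: contra eB; exact: submx_trans.
Qed.

Lemma is_completion_tr n m (A : partial_matrix F n m) B :
  is_completion A B -> is_completion A^T B^T.
Proof. by move=> complB j i a; rewrite !mxE => /complB. Qed.

(** Discarding the zero coordinates of x turns the relation x B = 0 into a
    relation between the rows of the submatrix, whatever its columns are. *)
Lemma rank_kernel_support n m (A : partial_matrix F n m) (B : 'M_(n, m))
    (x : 'rV_n) (R := [set i | x 0 i != 0]) (C : {set 'I_m}) :
    is_completion A B -> x *m B = 0 -> x != 0 -> setX R C \subset pattern A ->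
  (\rank (specified_submx A R C) < #|R|)%N.
Proof.
move=> complB xB x0 RC.
have specE k c : specified_submx A R C k c = B (enum_val k) (enum_val c).
  have /(subsetP RC) : (enum_val k, enum_val c) \in setX R C.
    by rewrite in_setX !enum_valP.
  rewrite mem_pattern [LHS]mxE; case E: (A _ _) => [a|] //= _.
  by rewrite (complB _ _ _ E).
rewrite ltn_neqAle rank_leq_row andbT; apply/negP => freeS.
have xS : (\row_k x 0 (enum_val k)) *m specified_submx A R C = 0.
  apply/rowP => c; rewrite !mxE.
  have /rowP/(_ (enum_val c)) := xB; rewrite !mxE => xBc.
  rewrite -[RHS]xBc [RHS](bigID (mem R)) /=.
  rewrite [X in _ = _ + X]big1 ?addr0 => [|k]; last first.
    by rewrite inE negbK => /eqP->; rewrite mul0r.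
  by rewrite [RHS]big_enum_val; apply: eq_bigr => k _; rewrite mxE specE.
rewrite -(mul0mx _ (specified_submx A R C)) in xS.
case/rV0Pn: x0 => i xi; have iR : i \in R by rewrite inE.
have := congr1 (fun w : 'rV_ _ => w 0 (enum_rank_in iR i))
               (row_free_inj freeS xS).
by rewrite !mxE enum_rankK_in // => /eqP; rewrite (negPf xi).
Qed.

Lemma increase_rank n m (A : partial_matrix F n m) (B : 'M_(n, m)) :
    full_rank A -> is_completion A B -> (\rank B < minn n m)%N ->
  exists B', is_completion A B' /\ \rank B' = (\rank B).+1.
Proof.
move=> fullA complB; rewrite leq_min => /andP[ltn ltm].
have : kermx B != 0 by rewrite kermx_eq0 /row_free neq_ltn ltn.
case/rowV0Pn => x /sub_kermxP xB x0.
have : kermx B^T != 0 by rewrite kermx_eq0 /row_free mxrank_tr neq_ltn ltm.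
case/rowV0Pn => y /sub_kermxP yB y0.
have [RC | ] := boolP (setX [set i | x 0 i != 0] [set j | y 0 j != 0]
                         \subset pattern A).
  have := rank_kernel_support complB xB x0 RC.
  have CR := RC; rewrite -setX_pattern_tr in CR.
  have := rank_kernel_support (is_completion_tr complB) yB y0 CR.
  rewrite specified_submx_tr mxrank_tr fullA //.
  by rewrite !gtn_min !ltnn orbF => /ltnW; rewrite leqNgt => /negP.
case/subsetPn => -[i j]; rewrite !inE /= => /andP[xi yj] ijA.
exists (B + delta_mx i j); split; last first.
  have By : B *m y^T = 0 by rewrite -[B]trmxK -trmx_mul yB trmx0.
  by apply: (mxrank_add_delta xB By) => //; rewrite mxE.
move=> k c a kcA; rewrite 2!mxE (complB _ _ _ kcA).
case: andP; rewrite ?addr0 // => -[/eqP kE /eqP cE].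
by move: ijA; rewrite -kE -cE kcA.
Qed.

Lemma complete_to_rank n m r (A : partial_matrix F n m) (B : 'M_(n, m)) :
    full_rank A -> is_completion A B -> (\rank B <= r <= minn n m)%N ->
  exists B', is_completion A B' /\ \rank B' = r.
Proof.
move=> fullA; have [d] := ubnP (r - \rank B)%N.
elim: d B => // d IHd B le_d complB /andP[le_Br le_r].
have [ltBr | le_rB] := ltnP (\rank B) r; last first.
  by exists B; split=> //; apply/eqP; rewrite eqn_leq le_Br.
have [B' [complB' rankB']] :=
  increase_rank fullA complB (leq_trans ltBr le_r).
by apply: (IHd B') => //; rewrite rankB' ?ltBr //; lia.
Qed.

End Completion.

(** * The completion theorem *)

Lemma subset_of_card (T : finType) (B : {set T}) k :
  (k <= #|B|)%N -> exists2 D : {set T}, D \subset B & #|D| = k.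
Proof.
case/card_geqP => s [uniq_s <- sB]; exists [set x in s].
  by apply/subsetP => x; rewrite inE => /sB.
by rewrite cardsE; apply/card_uniqP.
Qed.

Theorem theorem3p2 (F : fieldType) (n m r : nat)
    (n_ge1 : (1 <= n)%N) (m_ge1 : (1 <= m)%N)
    (r_ge1 : (1 <= r)%N) (r_le : (r <= minn n m)%N)
    (J : {set 'I_n * 'I_m}) (J_banded : banded J)
    (A : partial_matrix F n m) (A_pattern : pattern A = J)
    (A_full_rank : forall (R : {set 'I_n}) (C : {set 'I_m}),
       R != set0 -> C != set0 -> setX R C \subset J ->
       \rank (specified_submx A R C) = minn #|R| #|C|)
    (A_sparse : forall k : nat, (r <= k <= minn n m)%N ->
       forall (R : {set 'I_n}) (C : {set 'I_m}), #|R| = k -> #|C| = k ->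
       (#|J :&: setX R C| <= (2 * k - r) * r)%N) :
  exists B : 'M[F]_(n, m), is_completion A B /\ \rank B = r.
Proof.
subst J.
(* The hypothesis is extended to empty sets of rows or columns, which occur as
   sets of active rows or columns. *)
have fullA : full_rank A.
  move=> R C RC; have [R0 | R0] := eqVneq R set0.
    apply/eqP; rewrite eqn_leq leq_min rank_leq_row rank_leq_col.
    by rewrite R0 {1}cards0 min0n.
  have [C0 | C0] := eqVneq C set0; last exact: A_full_rank.
  apply/eqP; rewrite eqn_leq leq_min rank_leq_row rank_leq_col.
  by rewrite C0 {1}cards0 minn0.
have thinA : thin r A.
  move=> R C RC; rewrite leqNgt leq_min; apply/negP => /andP[ltrR ltrC].
  have [R' sR'R R'r] := subset_of_card ltrR.
  have [C' sC'C C'r] := subset_of_card ltrC.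
  have ltr : (r < minn n m)%N.
    have := max_card (mem C'); have := max_card (mem R').
    by rewrite !card_ord R'r C'r leq_min => -> ->.
  have := A_sparse r.+1; rewrite leqnSn ltr => /(_ isT R' C' R'r C'r).
  rewrite (setIidPr _) ?cardsX ?R'r ?C'r; first lia.
  exact: subset_trans (setXS sR'R sC'C) RC.
have [U [V complUV]] := exists_factorization J_banded fullA thinA.
apply: (complete_to_rank fullA complUV).
by rewrite r_le andbT mulmx_max_rank.
Qed.
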